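(* Let $X$ be a $\Pi$-pseudo-metric space. Then the following are equivalent: $X$ is Baire; $X$ is $\beta$-défavorable of $\mathcal{J}_p$; $X$ is $\sigma$-well $\beta$-défavorable of $\mathcal{J}_p$; $X$ is $\tau$-well $\beta$-défavorable of $\mathcal{J}_p$.
   Context: No separation axioms are assumed. A $\Pi$-pseudo-metric space is a space homeomorphic to the product of a family of pseudo-metric spaces. $\mathscr{O}(X)$ is the family of non-void open subsets of $X$. $X$ is Baire if no $U\in\mathscr{O}(X)$ is meager in $X$ (meager: countable union of sets whose closures have empty interior). A $\mathcal{J}_p(X)$-play is a sequence $\{(B_i;A_i,a_i)\}_{i=1}^\infty$ in $\mathscr{O}(X)\times\mathscr{O}(X)\times X$ with $B_i\supseteq A_i\supseteq B_{i+1}$ for all $i$; Player $\beta$ moves first and picks the $B_i$, Player $\alpha$ picks the $(A_i,a_i)$, alternately (the points $a_i\in X$ are otherwise arbitrary). Player $\alpha$ wins the play if $\overline{\{a_i : i\in\mathbb{N}\}}\cap\bigcap_i A_i\neq\emptyset$; wins it $\sigma$-well if every subsequence of $\{a_n\}$ has a cluster point in $\bigcap_n A_n$; wins it $\tau$-well if every subnet of $\{a_n\}$ has a cluster point in $\bigcap_n A_n$. In each of the three versions of the game, Player $\beta$ wins (resp. wins $\sigma$-well, $\tau$-well) when Player $\alpha$ does not. A strategy for Player $\beta$ determines each of his moves from the previous moves of Player $\alpha$, and it is winning (resp. $\sigma$-well, $\tau$-well winning) if he wins (resp. $\sigma$-well, $\tau$-well) every play consistent with it. $X$ is $\beta$-défavorable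 (resp. $\sigma$-well, $\tau$-well $\beta$-défavorable) of $\mathcal{J}_p$ if Player $\beta$ has no winning (resp. $\sigma$-well, $\tau$-well winning) strategy in the $\mathcal{J}_p(X)$-game. *)

(* Defs.v *)
From mathcomp Require Import all_boot all_order all_algebra.
From mathcomp Require Import all_classical all_reals all_analysis.

Set Implicit Arguments.
Unset Strict Implicit.
Unset Printing Implicit Defensive.

Local Open Scope classical_set_scope.

Definition homeomorphic (X Y : topologicalType) : Prop :=
  exists (f : X -> Y) (g : Y -> X),
    [/\ cancel f g, cancel g f, continuous f & continuous g].

(* The index type may be empty or uncountable, and no factor need be Hausdorff
   or inhabited. *)
Definition Pi_pseudo_metric (R : realType) (X : topologicalType) : Prop :=
  exists (I : Type) (T : I -> pseudoMetricType R),
    homeomorphic X (prod_topology (fun i => T i : topologicalType)).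

Definition nonvoid_open (X : topologicalType) (U : set X) : Prop :=
  open U /\ U !=set0.

Definition meager (X : topologicalType) (U : set X) : Prop :=
  exists F : nat -> set X,
    (forall n, interior (closure (F n)) = set0) /\ U = \bigcup_n F n.

Definition baire_space (X : topologicalType) : Prop :=
  forall U : set X, nonvoid_open U -> ~ meager U.

Section Game.
Variable X : topologicalType.
Implicit Types (A B : nat -> set X) (a : nat -> X).

(* The sequences are indexed from 0: B 0 is the first move of the game. *)
Definition Jp_play B A a : Prop :=
  forall i, [/\ nonvoid_open (B i), nonvoid_open (A i),
                A i `<=` B i & B i.+1 `<=` A i].

Definition alpha_wins A a : Prop :=
  closure (range a) `&` \bigcap_n A n !=set0.

Definition alpha_wins_sigma_well A a : Prop :=
  forall phi : nat -> nat, {homo phi : m n / (m < n)%N} ->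
    cluster ((a \o phi) @ \oo) `&` \bigcap_n A n !=set0.

Definition directed (D : Type) (le : D -> D -> Prop) : Prop :=
  [/\ inhabited D, forall d, le d d,
      forall d e f, le d e -> le e f -> le d f
    & forall d e, exists f, le d f /\ le e f].

Definition net_tails (D : Type) (le : D -> D -> Prop) : set_system D :=
  [set P | exists d0, forall d, le d0 d -> P d].

(* Subnets in the sense of Kelley: h is eventually above every n, but need not
   be monotone. *)
Definition alpha_wins_tau_well A a : Prop :=
  forall (D : Type) (le : D -> D -> Prop) (h : D -> nat), directed le ->
    (forall n, exists d0, forall d, le d0 d -> (n <= h d)%N) ->
    cluster ((a \o h) @ net_tails le) `&` \bigcap_n A n !=set0.

(* A strategy for beta maps the list of the previous moves of alpha, the oldest
   one first, to the next move of beta; its values on lists that do not arise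
   from a legal position consistent with it are irrelevant. *)
Implicit Types (s : seq (set X * X) -> set X) (h : seq (set X * X)).

Inductive position s : seq (set X * X) -> Prop :=
| position_nil : position s [::]
| position_rcons h (U : set X) (x : X) :
    position s h -> nonvoid_open U -> U `<=` s h ->
    position s (rcons h (U, x)).

Definition beta_strategy s : Prop :=
  nonvoid_open (s [::]) /\
  forall h (U : set X) (x : X), position s (rcons h (U, x)) ->
    nonvoid_open (s (rcons h (U, x))) /\ s (rcons h (U, x)) `<=` U.

Definition consistent s B A a : Prop :=
  forall i, B i = s (mkseq (fun j => (A j, a j)) i).

Definition beta_winning (W : (nat -> set X) -> (nat -> X) -> Prop) s : Prop :=
  forall B A a, Jp_play B A a -> consistent s B A a -> ~ W A a.

(* W is the winning condition of alpha. *)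
Definition beta_defavorable (W : (nat -> set X) -> (nat -> X) -> Prop) : Prop :=
  ~ exists s, beta_strategy s /\ beta_winning W s.

End Game.

(* Main.v *)
Require Import Defs.
From mathcomp Require Import all_boot all_order all_algebra.
From mathcomp Require Import all_classical all_reals all_analysis.

(** Winning tau-well is the strongest of the three winning conditions and
    plain winning the weakest, so the three game properties decrease in
    strength from tau-well to plain; and a space that is not Baire lets Player
    beta dodge a sequence of nowhere dense sets one by one
    ([defavorable_baire]).  The content is therefore that a Baire
    Pi-pseudo-metric space is tau-well beta-defavorable.

    Fix a strategy for beta and a base point z of the space.  Player alpha
    restricts himself to [small_box] moves: at round n the open set A n
    constrains only a finite set J n of coordinates, where J n grows with n;
    on J n every point of A n is within 1/(n+1) of the point a n; and off J n the point a n
    agrees with z.  Such moves are available inside every non-void open set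
    ([small_box_exists]), and this is all that the Baire property needs to
    produce, against the given strategy, a play by small boxes whose sets A n
    have a common point x ([baire_tree_branch]).

    The point x itself need not be a limit of the a n, which know nothing of
    its coordinates outside the countable union of the J n.  Replace those
    coordinates by the ones of z.  The resulting point y is still in every
    A n, as A n does not see the change, and now a n converges to y coordinate
    by coordinate: on the union of the J n because the boxes shrink, elsewhere
    because both agree with z ([cvg_small_boxes]).  A sequence that converges
    to a point of all the A n wins tau-well ([cvg_tau_well]). *)

Set Implicit Arguments.
Unset Strict Implicit.
Unset Printing Implicit Defensive.

Import Order.TTheory GRing.Theory Num.Theory.
Local Open Scope classical_set_scope.

(** * Comparison of the winning conditions *)

Lemma tau_well_sigma_well (X : topologicalType) (A : nat -> set X)
    (a : nat -> X) :
  alpha_wins_tau_well A a -> alpha_wins_sigma_well A a.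
Proof.
move=> tau phi phi_incr.
have phi_ge n : (n <= phi n)%N.
  by elim: n => // n IHn; exact: leq_ltn_trans IHn (phi_incr _ _ (ltnSn n)).
have [||y [ay Ay]] := tau nat leq phi.
- split; [exact: (inhabits 0%N)|by []|by move=> d e f; exact: leq_trans|].
  by move=> d e; exists (maxn d e); rewrite leq_maxl leq_maxr.
- by move=> n; exists n => d nd; exact: leq_trans nd (phi_ge d).
exists y; split=> // P Q [N _ NP] Qy; apply: ay => //.
by exists N => d Nd; exact: NP.
Qed.

Lemma sigma_well_wins (X : topologicalType) (A : nat -> set X) (a : nat -> X) :
  alpha_wins_sigma_well A a -> alpha_wins A a.
Proof.
move=> /(_ id) [//|y [ay Ay]]; exists y; split=> // B By.
by apply: ay => //; exists 0%N => // n _; exists n.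
Qed.

Lemma beta_defavorable_mono (X : topologicalType)
    (W W' : (nat -> set X) -> (nat -> X) -> Prop) :
  (forall A a, W A a -> W' A a) -> beta_defavorable W -> beta_defavorable W'.
Proof.
move=> WW' defW [s [s_strat s_win]]; apply: defW; exists s; split=> //.
by move=> B A a play cons /WW'; exact: s_win cons.
Qed.

(** * Defavorable spaces are Baire *)

Lemma open_setD_closure (X : topologicalType) (U F : set X) :
  interior (closure F) = set0 -> nonvoid_open U ->
  nonvoid_open (U `\` closure F).
Proof.
move=> F0 [oU [x Ux]]; split.
  by rewrite setDE; apply: openI => //; exact: closed_openC (@closed_closure _ _).
apply: contrapT => U0; have : interior (closure F) x.
  rewrite /interior nbhsE; exists U => // y Uy; apply: contrapT => Fy.
  by apply: U0; exists y.
by rewrite F0.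
Qed.

(** If U is the union of nowhere dense sets F n, then beta opens with U and
    removes the closure of F n from the n-th answer of alpha: no point survives
    all the rounds. *)
Lemma defavorable_baire (X : topologicalType) :
  beta_defavorable (@alpha_wins X) -> baire_space X.
Proof.
move=> defX U U_open [F [F_nwd UF]]; apply: defX.
(* The answer to a history of length n.+1 removes the n-th nowhere dense
   set, hence the predecessor. *)
pose s (h : seq (set X * X)) :=
  if h is _ :: _ then (last U (unzip1 h)) `\` closure (F (size h).-1) else U.
have sE h V x : s (rcons h (V, x)) = V `\` closure (F (size h)).
  by rewrite /s; case: h => //= p h; rewrite /unzip1 map_rcons last_rcons size_rcons.
exists s; split.
  split=> // h V x; rewrite sE; move E : (rcons h (V, x)) => g pos.
  case: pos E => [|h' V' x' _ V_open _]; first by case: h.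
  move=> /rcons_inj[_ -> _]; split; first exact: open_setD_closure.
  by move=> y [].
move=> B A a play cons [y [_ Ay]].
have Uy : U y.
  by have [_ _ AB _] := play 0%N; have /AB := Ay 0%N I; rewrite cons.
move: (Uy); rewrite UF => -[n _ Fny].
have [_ _ AB _] := play n.+1.
have /AB := Ay n.+1 I; rewrite cons mkseqS sE size_mkseq => -[_]; apply.
exact: subset_closure.
Qed.

(** * Branches of trees of open sets in a Baire space *)

Lemma baire_bigcap (X : topologicalType) (U : set X) (W : nat -> set X) :
  baire_space X -> nonvoid_open U -> (forall n, open (W n)) ->
  (forall n V, nonvoid_open V -> V `<=` U -> V `&` W n !=set0) ->
  U `&` \bigcap_n W n !=set0.
Proof.
move=> baireX U_open W_open W_dense; apply: contrapT => UW0.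
apply: (baireX U U_open); exists (fun n => U `\` W n); split=> [n|].
  rewrite -subset0 => x; rewrite /interior nbhsE => -[G [oG Gx] GF].
  have [z [Uz Gz]] : (U `\` W n) `&` G !=set0.
    by apply: (GF x Gx G); exact: open_nbhs_nbhs.
  have oGU : open (G `&` U) by apply: openI => //; case: U_open.
  have [||t [[Gt Ut] Wt]] := W_dense n (G `&` U).
  - by split=> //; exists z; split=> //; case: Uz.
  - by move=> t [].
  have [|r [[_ Wr] [_ Wr']]] := GF t Gt (G `&` U `&` W n).
    by apply: open_nbhs_nbhs; split; [exact: openI|].
  exact: Wr.
apply/seteqP; split=> [x Ux|x [n _ []//]].
apply: contrapT => xW; apply: UW0; exists x; split=> // n _.
by apply: contrapT => Wx; apply: xW; exists n.
Qed.

(** This is the combinatorial half of the Banach-Mazur argument.  P is a tree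
    of finite sequences labelled by non-void open sets, in which the labels of
    the successors of a node form a pi-base of its label.  At each node, thin
    the successors out to a family with pairwise disjoint labels, maximal as
    such; by maximality their union is dense in the label of the node.  The
    nodes that remain at level n thus have disjoint labels with union dense in
    the label of the root, and a point x common to these unions, which exists in a Baire space, picks
    out one node at each level.  These nodes form a branch. *)
Lemma baire_tree_branch (X : topologicalType) (M : Type)
    (P : set (seq M)) (t : seq M -> set X) :
  baire_space X -> P [::] ->
  (forall h, P h -> nonvoid_open (t h)) ->
  (forall h m, P (rcons h m) -> t (rcons h m) `<=` t h) ->
  (forall h V, P h -> nonvoid_open V -> V `<=` t h ->
    exists m, P (rcons h m) /\ t (rcons h m) `<=` V) ->
  exists (m : nat -> M) (x : X),
    forall n, P (mkseq m n) /\ t (mkseq m n) x.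
Proof.
move=> baireX P0 t_open t_anti t_base.
pose B h m := t (rcons h m).
pose C h := sval (ex_maximal_disjoint_subcollection (B h) [set m | P (rcons h m)]).
have C_max h := svalP (ex_maximal_disjoint_subcollection (B h)
                                          [set m | P (rcons h m)]).
rewrite -/(C _) in C_max.
have CP h m : C h m -> P (rcons h m) by case: (C_max h) => + _ _; apply.
have C_disj h m m' x : C h m -> C h m' -> t (rcons h m) x ->
    t (rcons h m') x -> m = m'.
  by case: (C_max h) => _ + _ => tI Cm Cm' tx tx'; apply: tI => //; exists x.
(* A successor with label inside V that met none of the chosen labels could be
   added to the chosen ones. *)
have C_dense h V : P h -> nonvoid_open V -> V `<=` t h ->
    exists m, C h m /\ V `&` t (rcons h m) !=set0.
  move=> Ph V_open Vt; have [m [Pm mV]] := t_base _ _ Ph V_open Vt.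
  apply: contrapT => noC.
  have meets m' : C h m' -> ~ (t (rcons h m) `&` t (rcons h m') !=set0).
    move=> Cm' [x [tx tx']]; apply: noC; exists m'; split=> //.
    by exists x; split=> //; exact: mV.
  have [x tx] := (t_open _ Pm).2.
  have nCm : ~ C h m by move=> /meets; apply; exists x.
  case: (C_max h) => CD Ctriv /(_ (C h `|` [set m])); apply.
  - by split=> [m' Cm'|/(_ m (or_intror erefl))]; [left|].
  - by move=> m' [/CD//|->].
  - move=> m1 m2 [C1|->] [C2|->] //.
    + exact: Ctriv.
    + by rewrite setIC => /(meets _ C1).
    + by move=> /(meets _ C2).
(* The nodes at level n that survive the thinning. *)
pose fix L n : set (seq M) := if n is k.+1 then
  [set g | exists h m, [/\ L k h, C h m & g = rcons h m]] else [set [::]].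
have LP n h : L n h -> P h.
  by case: n => [->//|n [h' [m [_ /CP Pm ->]]]].
have L_disj n h h' x : L n h -> L n h' -> t h x -> t h' x -> h = h'.
  elim: n h h' => [h h' -> -> //|n IHn g g' [h [m [Lh Cm ->]]]].
  move=> [h' [m' [Lh' Cm' ->]]] tx tx'.
  have hh' : h = h'.
    by apply: IHn => //; [exact: t_anti (CP _ _ Cm) _ tx
                         |exact: t_anti (CP _ _ Cm') _ tx'].
  by rewrite -hh' in Cm' tx' *; rewrite (C_disj _ _ _ _ Cm Cm' tx tx').
pose W n := \bigcup_(h in L n) t h.
have [||x [_ Wx]] := @baire_bigcap X (t [::]) W baireX (t_open _ P0).
- by move=> n; apply: bigcup_open => h /LP/t_open[].
- elim=> [|n IHn] V V_open Vt.
    by have [_ [x Vx]] := V_open; exists x; split=> //; exists [::] => //; exact: Vt.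
  have [x [Vx [h Lh tx]]] := IHn _ V_open Vt.
  have [|||m [Cm [y [[Vy _] ty]]]] := C_dense h (V `&` t h); first exact: LP Lh.
  + split; last by exists x.
    by apply: openI; [case: V_open|case: (t_open _ (LP _ _ Lh))].
  + by move=> ? [].
  by exists y; split=> //; exists (rcons h m) => //; exists h, m.
(* The first alternative below is the only one met on the branch; the other
   makes the successor a total function of the node. *)
have step h : exists m, forall n, L n h -> t h x ->
    L n.+1 (rcons h m) /\ t (rcons h m) x.
  have [[n [Lh tx]]|nL] := pselect (exists n, L n h /\ t h x).
    have [_ [h' [m [Lh' Cm ->]]] tx'] := Wx n.+1 I.
    have hh' : h = h'.
      by apply: (L_disj n _ _ x) => //; exact: t_anti (CP _ _ Cm) _ tx'.
    by exists m => k; rewrite hh' => Lk _; split=> //; exists h', m.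
  have [m0 _] := t_base [::] (t [::]) P0 (t_open _ P0) (@subset_refl _ _).
  by exists m0 => n Lh tx; case: nL; exists n.
have [m mP] := choice step.
pose H := fix H n := if n is k.+1 then rcons (H k) (m (H k)) else [::].
exists (m \o H), x => n.
have HE k : mkseq (m \o H) k = H k by elim: k => // k IHk; rewrite mkseqS IHk.
rewrite HE; suff [/LP] : L n (H n) /\ t (H n) x by [].
elim: n => [|n [LH tH]]; last by have := mP _ _ LH tH.
by split=> //; have [_ /= -> ] := Wx 0%N I.
Qed.

(** * Neighbourhoods and convergence in products *)

Lemma prod_cvgP (I : Type) (T : I -> topologicalType)
    (F : set_system (prod_topology T)) (p : prod_topology T) : Filter F ->
  F --> p <-> forall i, (fun q : prod_topology T => q i) @ F --> p i.
Proof.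
move=> FF; split=> [/cvg_sup Fp i Q pQ|Fp].
  exact/(Fp i)/(initial_continuous (f := fun q : prod_topology T => q i)).
apply/cvg_sup => i Q [_ [[C oC <-] Cp] CQ].
by apply: (filterS CQ); apply: (Fp i); exact: open_nbhs_nbhs.
Qed.

(** The sets V in the conclusion form a filter which converges to p coordinate
    by coordinate, hence in the product; so each neighbourhood of p is in it.
    A common radius suffices for finitely many coordinates. *)
Lemma prod_nbhs_ball (R : realType) (I : Type) (T : I -> pseudoMetricType R)
    (p : prod_topology (fun i => T i : topologicalType))
    (V : set (prod_topology (fun i => T i : topologicalType))) :
  nbhs p V -> exists (J : set I) (e : R), [/\ finite_set J, (0 < e)%R &
    forall q, (forall i, J i -> ball (p i) e (q i)) -> V q].
Proof.
set T' := fun i => T i : topologicalType.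
pose F : set_system (prod_topology T') :=
  [set V | exists (J : set I) (e : R), [/\ finite_set J, (0 < e)%R &
    forall q, (forall i, J i -> ball (p i) e (q i)) -> V q]].
have FF : Filter F.
  split.
  - by exists set0, 1%R; split.
  - move=> P Q [J [e [Jfin e0 JP]]] [K [d [Kfin d0 KQ]]].
    exists (J `|` K), (Num.min e d); split; first by rewrite finite_setU.
      by rewrite lt_min e0 d0.
    move=> q qJK; split.
      apply: JP => i Ji; apply: le_ball (qJK i (or_introl Ji)).
      by rewrite ge_min lexx.
    apply: KQ => i Ki; apply: le_ball (qJK i (or_intror Ki)).
    by rewrite ge_min lexx orbT.
  - by move=> P Q PQ [J [e [Jfin e0 JP]]]; exists J, e; split=> // q /JP/PQ.
suff Fp : F --> p by exact: Fp.
apply/prod_cvgP => i Q /nbhs_ballP[e /= e0 eQ].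
by exists [set i], e; split=> // q /(_ i erefl)/eQ.
Qed.

Lemma filter_finite_forall (I S : Type) (F : set_system S) (J : set I)
    (Q : I -> set S) : Filter F -> finite_set J ->
  (forall i, J i -> F (Q i)) -> F [set x | forall i, J i -> Q i x].
Proof.
move=> FF /(@finite_fsetP {classic I})[D ->] FQ.
pose Q' : {classic I} -> set S := Q.
by apply: filterS (@filter_bigI S {classic I} D Q' F FF FQ) => x Qx i Di; exact: Qx.
Qed.

(** * Small boxes *)

Section SmallBoxes.
Variables (R : realType) (X : topologicalType) (I : Type)
  (T : I -> pseudoMetricType R).
Variables (f : X -> prod_topology (fun i => T i : topologicalType))
  (g : prod_topology (fun i => T i : topologicalType) -> X).
Hypotheses (fK : cancel f g) (gK : cancel g f)
  (f_cont : continuous f) (g_cont : continuous g).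

(** Coordinates are read off through f, so that the game is played on X itself
    and strategies need not be carried over to the product.  The first clause
    says that A is the preimage of a set of families indexed by J. *)
Definition small_box (z : X) (e : R) (A : set X) (a : X) (J : set I) : Prop :=
  [/\ forall x y, (forall i, J i -> f x i = f y i) -> A x -> A y,
      forall x i, J i -> A x -> ball (f x i) e (f a i) &
      forall i, ~ J i -> f a i = f z i].

Lemma coord_continuous i : continuous (fun x => f x i).
Proof.
move=> x; have /prod_cvgP : f @ x --> f x by exact: f_cont.
exact.
Qed.

Lemma small_box_exists (z : X) (e : R) (J0 : set I) (V : set X) :
  (0 < e)%R -> finite_set J0 -> nonvoid_open V ->
  exists (A : set X) (a : X) (J : set I),
    [/\ nonvoid_open A, A `<=` V, finite_set J, J0 `<=` J &
        small_box z e A a J].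
Proof.
move=> e0 J0fin [oV [v Vv]].
have [|J1 [d [J1fin d0 dV]]] := @prod_nbhs_ball _ _ _ (f v) (g @^-1` V).
  by apply: g_cont; rewrite fK; exact: open_nbhs_nbhs.
pose J := J0 `|` J1; pose r := Num.min e d.
have r0 : (0 < r)%R by rewrite lt_min e0.
have Jfin : finite_set J by rewrite finite_setU.
pose A := [set x | forall i, J i -> interior (ball (f v i) r) (f x i)].
pose a := g (fun i => if pselect (J i) then f v i else f z i).
exists A, a, J; split=> //.
- split.
    rewrite openE => x Ax; apply: filter_finite_forall => // i Ji.
    apply: coord_continuous; apply: open_nbhs_nbhs.
    by split; [exact: open_interior|exact: Ax].
  by exists v => i _; exact/nbhsx_ballx.
- move=> x Ax; rewrite -[x]fK; apply: dV => i J1i.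
  have /interior_subset := Ax i (or_intror J1i).
  by apply: le_ball; rewrite ge_min lexx orbT.
- by move=> i; left.
rewrite /small_box /a gK; split=> [x y xy Ax i Ji|x i Ji Ax|i nJi].
- by rewrite -xy //; exact: Ax.
- case: (pselect (J i)) => [Ji'|//]; apply: ball_sym.
  have /interior_subset := Ax i Ji.
  by apply: le_ball; rewrite ge_min lexx.
- by case: pselect.
Qed.

(** The limit y is x modified off the union of the J n so as to agree with z
    there, like all the a n do; membership in A n only depends on J n. *)
Lemma cvg_small_boxes (z x : X) (A : nat -> set X) (a : nat -> X)
    (J : nat -> set I) :
  (forall n, small_box z n.+1%:R^-1 (A n) (a n) (J n)) ->
  (forall n, J n `<=` J n.+1) -> (forall n, A n x) ->
  exists y, (forall n, A n y) /\ a @ \oo --> y.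
Proof.
move=> boxes JS Ax.
have J_mono n k : (n <= k)%N -> J n `<=` J k.
  apply: (@homo_leq _ J subset _ _ JS); first by move=> ?; exact: subset_refl.
  by move=> C B D; exact: subset_trans.
pose p : prod_topology (fun i => T i : topologicalType) :=
  fun i => if pselect (exists n, J n i) then f x i else f z i.
have Ap n : A n (g p).
  have [An _ _] := boxes n; apply: An (Ax n) => i Ji.
  by rewrite gK /p; case: pselect => // -[]; exists n.
exists (g p); split=> //.
have -> : a = g \o (f \o a) by apply/funext => n /=; rewrite fK.
apply: (cvg_comp (f \o a) g _ (@g_cont p)).
apply/prod_cvgP => i Q.
rewrite /p; case: pselect => [[n Jni]|nJ].
  move=> /nbhs_ballP[e /= e0 eQ].
  have [N _ Ne] := near_infty_natSinv_lt (PosNum e0).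
  exists (maxn n N) => // k; rewrite /= geq_max => /andP[nk Nk].
  apply: eQ; have [_ /(_ (g p) i) + _] := boxes k.
  move=> /(_ (J_mono _ _ nk i Jni) (Ap k)); rewrite gK /p.
  case: (pselect (exists n, J n i)) => [Ji|[]]; last by exists n.
  by apply: le_ball; apply/ltW; exact: Ne.
move=> /nbhs_singleton Qz; exists 0%N => // n _ /=.
by have [_ _ ->] := boxes n => // Ji; apply: nJ; exists n.
Qed.

End SmallBoxes.

(** * Plays by small boxes *)

Lemma cvg_tau_well (X : topologicalType) (A : nat -> set X) (a : nat -> X)
    (y : X) : (forall n, A n y) -> a @ \oo --> y -> alpha_wins_tau_well A a.
Proof.
move=> Ay ay D le h [_ le_refl le_trans dir] h_infty; exists y; split.
  move=> P Q [d1 d1P] yQ; have [N _ NQ] := ay _ yQ.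
  have [d0 d0N] := h_infty N; have [d [d0d d1d]] := dir d0 d1.
  by exists (a (h d)); split; [exact: d1P|apply: NQ; exact: d0N].
by move=> n _; exact: Ay.
Qed.

Section Play.
Variables (R : realType) (X : topologicalType) (I : Type)
  (T : I -> pseudoMetricType R).
Variables (f : X -> prod_topology (fun i => T i : topologicalType))
  (s : seq (set X * X) -> set X) (z : X).

(** Only the last entry counts: the sets of coordinates increase along the
    positions considered below. *)
Definition support (h : seq (set X * X * set I)) : set I := last set0 (unzip2 h).

(** A move of alpha is recorded with its set of coordinates, which A and a do
    not determine and which the next moves must include. *)
Inductive box_position : seq (set X * X * set I) -> Prop :=
| box_position_nil : box_position [::]
| box_position_rcons h A a J :
    box_position h -> nonvoid_open A -> A `<=` s (unzip1 h) ->
    finite_set J -> support h `<=` J ->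
    small_box f z (size h).+1%:R^-1 A a J ->
    box_position (rcons h (A, a, J)).

Lemma box_position_last h m : box_position (rcons h m) ->
  [/\ nonvoid_open m.1.1, m.1.1 `<=` s (unzip1 h), support h `<=` m.2 &
      small_box f z (size h).+1%:R^-1 m.1.1 m.1.2 m.2].
Proof.
move E : (rcons h m) => k bp.
case: bp E => [|h' A a J _ A_open As _ hJ box]; first by case: h.
by move=> /rcons_inj[-> ->].
Qed.

Lemma box_position_position h : box_position h -> position s (unzip1 h).
Proof.
elim=> [|h' A a J _ pos A_open As _ _ _]; first exact: position_nil.
by rewrite /unzip1 map_rcons; exact: position_rcons.
Qed.

Lemma box_position_finite h : box_position h -> finite_set (support h).
Proof. by case=> [|*]; rewrite /support /unzip2 ?map_rcons ?last_rcons. Qed.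

End Play.

(** Label a box position by the answer of beta.  Inside any non-void open part
    V of that answer alpha can play a small box, to which beta must answer
    within V; so the positions form a tree as required for a branch with a
    common point. *)
Lemma baire_tau_well_defavorable (R : realType) (X : topologicalType) :
  Pi_pseudo_metric R X -> baire_space X ->
  beta_defavorable (@alpha_wins_tau_well X).
Proof.
move=> [I [T [f [g [fK gK f_cont g_cont]]]]] baireX [s [[s0 sS] s_win]].
have [z _] := s0.2.
pose t (h : seq (set X * X * set I)) := s (unzip1 h).
have t_open h : box_position f s z h -> nonvoid_open (t h).
  case/lastP: h => [//|h [[A a] J] /box_position_position].
  by rewrite /t /unzip1 map_rcons => /sS[].
have t_sub h m : box_position f s z (rcons h m) -> t (rcons h m) `<=` m.1.1.
  case: m => -[A a] J /box_position_position.
  by rewrite /t /unzip1 map_rcons => /sS[].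
have [|h V bp V_open Vt|m [x branch]] :=
  @baire_tree_branch X _ (box_position f s z) t baireX
    (box_position_nil _ _ _) t_open.
- move=> h m bp; apply: subset_trans (t_sub _ _ bp) _.
  by case: (box_position_last bp).
- have e0 : (0 < (size h).+1%:R^-1 :> R)%R by rewrite invr_gt0 ltr0Sn.
  have [A [a [J [A_open AV Jfin hJ box]]]] :=
    small_box_exists fK gK f_cont g_cont z e0 (box_position_finite bp) V_open.
  have bp' : box_position f s z (rcons h (A, a, J)).
    by apply: box_position_rcons => //; exact: subset_trans AV Vt.
  exists (A, a, J); split=> //.
  by apply: subset_trans AV; exact: (t_sub _ _ bp').
(* The branch is a play against s in which all answers of beta, hence all the
   boxes, contain x. *)
pose A n := (m n).1.1; pose a n := (m n).1.2; pose J n := (m n).2.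
have bpS n : box_position f s z (rcons (mkseq m n) (m n)).
  by rewrite -mkseqS; case: (branch n.+1).
have Ax n : A n x.
  by apply: (t_sub _ _ (bpS n)); rewrite -mkseqS; case: (branch n.+1).
have [n|n|//|y [Ay ay]] := cvg_small_boxes fK gK g_cont
    (z := z) (x := x) (A := A) (a := a) (J := J).
- by have [_ _ _] := box_position_last (bpS n); rewrite size_mkseq.
- have [_ _ + _] := box_position_last (bpS n.+1).
  by rewrite mkseqS /support /unzip2 map_rcons last_rcons.
apply: (s_win (fun n => t (mkseq m n)) A a).
- move=> n; have [A_open AB _ _] := box_position_last (bpS n); split=> //.
    by apply: t_open; case: (branch n).
  by rewrite mkseqS; exact: t_sub.
- move=> n; rewrite /t /unzip1 /mkseq -map_comp; congr s.
  by apply: eq_map => k /=; rewrite -surjective_pairing.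
- exact: cvg_tau_well Ay ay.
Qed.

Theorem theorem3p21 (R : realType) (X : topologicalType)
    (hX : Pi_pseudo_metric R X) :
  [<-> baire_space X;
       beta_defavorable (@alpha_wins X);
       beta_defavorable (@alpha_wins_sigma_well X);
       beta_defavorable (@alpha_wins_tau_well X)].
Proof.
have baire_tau := baire_tau_well_defavorable hX.
have tau_sigma := beta_defavorable_mono (@tau_well_sigma_well X).
have sigma_wins := beta_defavorable_mono (@sigma_well_wins X).
have wins_baire := @defavorable_baire X.
tfae.
- by move=> /baire_tau/tau_sigma/sigma_wins.
- by move=> /wins_baire/baire_tau/tau_sigma.
- by move=> /sigma_wins/wins_baire/baire_tau.
- by move=> /tau_sigma/sigma_wins/wins_baire.
Qed.
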